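(* Linear braided nondegenerate injective sets $(X,S)$ on an abelian group $X$ are in 1-1 correspondence with triples $(p,q,z)$ of automorphisms of $X$ such that $pq=qp$ and $z^2-z(p+q)+pq=0$.
   Context: Let $X$ be a nonempty set and $S:X\times X\to X\times X$ a bijection, written $S(x,y)=(g_x(y),f_y(x))$. $(X,S)$ is a braided set if $S_1S_2S_1=S_2S_1S_2$ on $X^3$, where $S_1=S\times \mathrm{id}$, $S_2=\mathrm{id}\times S$; it is nondegenerate if all maps $g_x$ and $f_y$ are bijections of $X$. The structure group $G_X$ is the group generated by the elements of $X$ with relations $xy=y_1x_1$ whenever $S(x,y)=(y_1,x_1)$. A nondegenerate braided set is injective if the natural map $X\to G_X$ is injective. For an abelian group $X$, $(X,S)$ is linear if $S$ is an automorphism of the group $X\times X$, i.e. a bijection of the form $S(x,y)=(ax+by,cx+dy)$ with $a,b,c,d\in\mathrm{End}(X)$. *)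

(* Defs.v *)
From HB Require Import structures.
From mathcomp Require Import all_boot all_algebra.
From mathcomp Require Import boolp classical_sets functions.

Set Implicit Arguments.
Unset Strict Implicit.
Unset Printing Implicit Defensive.

Import GRing.Theory.

Local Open Scope quotient_scope.

Section BraidedSet.
Variables (X : choiceType) (S : X * X -> X * X).

(* S (x, y) = (g_x y, f_y x) *)
Definition gmap (x y : X) : X := (S (x, y)).1.
Definition fmap (y x : X) : X := (S (x, y)).2.

Definition S1 (t : X * X * X) : X * X * X :=
  let: (x, y, w) := t in (gmap x y, fmap y x, w).

Definition S2 (t : X * X * X) : X * X * X :=
  let: (x, y, w) := t in (x, gmap y w, fmap w y).

Definition braided : Prop :=
  bijective S /\ (forall t, S1 (S2 (S1 t)) = S2 (S1 (S2 t))).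

Definition nondegenerate : Prop :=
  (forall x, bijective (gmap x)) /\ (forall y, bijective (fmap y)).

(* The structure group is the set of words in the letters x = (false, x) and
   x^-1 = (true, x), modulo the least congruence containing the cancellations
   and the defining relations. *)
Definition word := seq (bool * X).

Inductive word_cong : word -> word -> Prop :=
| WordRefl u : word_cong u u
| WordSym u v : word_cong u v -> word_cong v u
| WordTrans v u w : word_cong u v -> word_cong v w -> word_cong u w
| WordCtx l r u v : word_cong u v -> word_cong (l ++ u ++ r) (l ++ v ++ r)
| WordCancel e x : word_cong [:: (e, x); (~~ e, x)] [::]
| WordRel x y : word_cong [:: (false, x); (false, y)]
                          [:: (false, gmap x y); (false, fmap y x)].

Definition word_inv (u : word) : word := rev [seq (~~ l.1, l.2) | l <- u].

Definition word_congb : rel word := fun u v => `[< word_cong u v >].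

Lemma word_congb_refl : reflexive word_congb.
Proof. by move=> u; apply/asboolP; exact: WordRefl. Qed.

Lemma word_congb_sym : symmetric word_congb.
Proof. by move=> u v; apply/asboolP/asboolP; exact: WordSym. Qed.

Lemma word_congb_trans : transitive word_congb.
Proof.
by move=> v u w /asboolP uv /asboolP vw; apply/asboolP; exact: WordTrans uv vw.
Qed.

Canonical word_congb_equiv :=
  EquivRel word_congb word_congb_refl word_congb_sym word_congb_trans.

Definition structure_group := {eq_quot word_congb}.

HB.instance Definition _ := Choice.on structure_group.

Definition sg_class (u : word) : structure_group := \pi_structure_group u.

Lemma sg_classP u v : sg_class u = sg_class v <-> word_cong u v.
Proof.
split; first by move/eqmodP => /= /asboolP.
by move=> uv; apply/eqmodP/asboolP.
Qed.

Lemma sg_class_repr a : sg_class (repr a) = a.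
Proof. exact: reprK. Qed.

Lemma word_cong_cat u u' v v' :
  word_cong u u' -> word_cong v v' -> word_cong (u ++ v) (u' ++ v').
Proof.
move=> uu' vv'; apply: (@WordTrans (u' ++ v)).
  exact: (@WordCtx [::] v u u').
by have := @WordCtx u' [::] v v' vv'; rewrite !cats0.
Qed.

Lemma word_invK : involutive word_inv.
Proof.
move=> u; rewrite /word_inv map_rev revK -map_comp -[RHS]map_id.
by apply: eq_map => -[e x] /=; rewrite negbK.
Qed.

Lemma word_cong_invr u : word_cong (u ++ word_inv u) [::].
Proof.
elim: u => [|[e x] u IHu]; first exact: WordRefl.
rewrite /word_inv /= rev_cons -cats1 -/(word_inv u).
apply: (WordTrans _ (WordCancel e x)).
by have := @WordCtx [:: (e, x)] [:: (~~ e, x)] _ _ IHu; rewrite /= -catA.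
Qed.

Lemma word_cong_invl u : word_cong (word_inv u ++ u) [::].
Proof. by have := word_cong_invr (word_inv u); rewrite word_invK. Qed.

Definition sg_one : structure_group := sg_class [::].
Definition sg_inv (a : structure_group) : structure_group :=
  sg_class (word_inv (repr a)).
Definition sg_mul (a b : structure_group) : structure_group :=
  sg_class (repr a ++ repr b).

Lemma sg_mulE u v : sg_mul (sg_class u) (sg_class v) = sg_class (u ++ v).
Proof.
by apply/sg_classP/word_cong_cat; apply/sg_classP; rewrite sg_class_repr.
Qed.

Lemma sg_mulA : associative sg_mul.
Proof.
move=> a b c; rewrite -(sg_class_repr a) -(sg_class_repr b) -(sg_class_repr c).
by rewrite !sg_mulE catA.
Qed.

Lemma sg_mul1g : left_id sg_one sg_mul.
Proof. by move=> a; rewrite -(sg_class_repr a) sg_mulE. Qed.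

Lemma sg_mulg1 : right_id sg_one sg_mul.
Proof. by move=> a; rewrite -(sg_class_repr a) sg_mulE cats0. Qed.

Lemma sg_mulVg : left_inverse sg_one sg_inv sg_mul.
Proof.
move=> a; rewrite -{2}(sg_class_repr a) sg_mulE.
by apply/sg_classP; exact: word_cong_invl.
Qed.

Lemma sg_mulgV : right_inverse sg_one sg_inv sg_mul.
Proof.
move=> a; rewrite -{1}(sg_class_repr a) sg_mulE.
by apply/sg_classP; exact: word_cong_invr.
Qed.

HB.instance Definition _ := isGroup.Build structure_group
  sg_mulA sg_mul1g sg_mulg1 sg_mulVg sg_mulgV.

Definition structure_map (x : X) : structure_group := sg_class [:: (false, x)].

Lemma structure_map_rel x y :
  (structure_map x * structure_map y
     = structure_map (gmap x y) * structure_map (fmap y x))%g.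
Proof.
rewrite /structure_map; transitivity (sg_class [:: (false, x); (false, y)]).
  exact: sg_mulE.
transitivity (sg_class [:: (false, gmap x y); (false, fmap y x)]).
  by apply/sg_classP; exact: WordRel.
by symmetry; exact: sg_mulE.
Qed.

Definition injective_braided : Prop := injective structure_map.

End BraidedSet.

Local Open Scope ring_scope.

Definition is_automorphism (G : zmodType) (f : G -> G) : Prop :=
  zmod_morphism f /\ bijective f.

Section LinearBraidedSet.
Variable X : zmodType.

(* automorphism of the product group X * X *)
Definition linear_set (S : X * X -> X * X) : Prop := is_automorphism S.

(* For linear S, S (x, y) = (coef_a x + coef_b y, coef_c x + coef_d y). *)
Definition coef_a (S : X * X -> X * X) (x : X) : X := (S (x, 0)).1.
Definition coef_b (S : X * X -> X * X) (y : X) : X := (S (0, y)).1.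
Definition coef_c (S : X * X -> X * X) (x : X) : X := (S (x, 0)).2.
Definition coef_d (S : X * X -> X * X) (y : X) : X := (S (0, y)).2.

Lemma linear_setE (S : X * X -> X * X) (linS : linear_set S) x y :
  S (x, y) = (coef_a S x + coef_b S y, coef_c S x + coef_d S y).
Proof.
have SB := linS.1.
have S0 : S 0 = 0 by have := SB 0 0; rewrite !subrr.
have SD u v : S (u + v) = S u + S v.
  by have := SB u (- v); rewrite opprK -[- v]sub0r SB S0 sub0r opprK.
have -> : (x, y) = (x, 0) + (0, y) :> X * X.
  by rewrite [RHS]surjective_pairing /= addr0 add0r.
by rewrite SD /coef_a /coef_b /coef_c /coef_d; case: (S _); case: (S _).
Qed.

Definition linear_solution (S : X * X -> X * X) : Prop :=
  [/\ linear_set S, braided S, nondegenerate S & injective_braided S].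

Definition auto_triple (t : (X -> X) * (X -> X) * (X -> X)) : Prop :=
  let: (p, q, z) := t in
  [/\ is_automorphism p, is_automorphism q, is_automorphism z,
      (forall x, p (q x) = q (p x))
    & (forall x, z (z x) - z (p x + q x) + p (q x) = 0)].

(* The triple attached to S = (a, b; c, d): b = p, z (1 - a) = p and
   q (1 - a) (1 - d) = p.  On solutions 1 - a and 1 - d are invertible, so this
   reads p = b, z = b (1 - a)^-1, q = b ((1 - a) (1 - d))^-1; conversely
   a = 1 - z^-1 p, b = p, c = p^-1 z q^-1 z^-1 p, d = 1 - p^-1 z q^-1 p. *)
Definition attached (S : X * X -> X * X)
    (t : (X -> X) * (X -> X) * (X -> X)) : Prop :=
  let: (p, q, z) := t in
  [/\ forall y, coef_b S y = p y,
      forall x, z (x - coef_a S x) = p x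
    & forall y, q ((y - coef_d S y) - coef_a S (y - coef_d S y)) = p y].

End LinearBraidedSet.

(* Main.v *)
From HB Require Import structures.
Require Import Defs.
From mathcomp Require Import all_boot all_algebra.
From mathcomp Require Import boolp classical_sets functions.

Set Implicit Arguments.
Unset Strict Implicit.
Unset Printing Implicit Defensive.

Import GRing.Theory.

Local Open Scope ring_scope.
Local Open Scope classical_set_scope.

(** Write S (x, y) = (a x + b y, c x + d y), u = 1 - a and v = 1 - d.  The proof
   passes through an intermediate parametrization of the solutions, by triples
   (b, u, v) of automorphisms with
     b u v = u v b    and    b v + u b = b + b u v,                         (R)
   where c = v b^-1 u; these data form the type [coefs] below and [braiding] is
   the corresponding map S.

   From a solution to (b, u, v) ([solution_braiding]).  In the structure group
   x y = g_x(y) f_y(x), so by cancellation and injectivity g_x(y) = x if and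
   only if f_y(x) = y; for linear S this says that b y = u x if and only if
   c x = v y ([injective_fixed]).  Nondegeneracy makes b and c invertible, so
   both u and v are invertible and c = v b^-1 u.  The relations (R) are then two
   of the entries of the braid equation.

   From (b, u, v) to a solution ([braiding_solution]).  Put tau = b v^-1 and let
   x act on X by the affine map t |-> x + tau t.  The action of the product x y
   equals that of g_x(y) f_y(x) ([affine_product]).  Hence the structure group
   acts on X, and evaluating at 0 recovers x, which gives injectivity.
   The same identity shortens the braid equation: both sides have the same first
   coordinate ([gmap_action]) and the same third coordinate ([fmap_action]), and
   the invariance of x + tau y + tau^2 w forces the middle ones to agree.

   Finally (b, u, v) corresponds to p = b, z = b u^-1, q = b v^-1 u^-1, under
   which u = z^-1 p and v = p^-1 z q^-1 p; the two relations (R) become pq = qp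
   and z^2 - z (p + q) + pq = 0 ([triple_auto], [triple_surj]).  The relation
   [attached] between S and (p, q, z) is exactly this correspondence
   ([attached_braiding]). *)

(** * Identities in abelian groups *)

Lemma eq_of_diff (X : zmodType) (x y : X) : x - y + 0 = 0 -> x = y.
Proof. by move/eqP; rewrite addr0 subr_eq0 => /eqP. Qed.

Lemma eq_by_diff (X : zmodType) (x y z t : X) : x - y = z - t -> z = t -> x = y.
Proof. by move=> xy_zt zt; apply: subr0_eq; rewrite xy_zt zt subrr. Qed.

(** [zmodule] decides identities that hold in every abelian group, the maximal
   subterms that are not sums or opposites being the generators.  The trailing 0
   supplied by [eq_of_diff] ensures that every summand has a right neighbour,
   so that [pull] can move the opposite of the head next to it. *)
Ltac cancel_head :=
  match goal with
  | |- 0 = 0 => reflexivity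
  | |- 0 + _ = 0 => rewrite add0r
  | |- - ?x + (?x + _) = 0 => rewrite addKr
  | |- ?x + (- ?x + _) = 0 => rewrite addNKr
  | |- - ?x + _ = 0 => pull x
  | |- ?x + _ = 0 => pull (- x)
  end
with pull y :=
  match goal with
  | |- context [?a + (y + ?r)] =>
      (* without this guard two equal summands would be swapped forever *)
      assert_fails (constr_eq a y); rewrite (addrCA a y r)
  end.

Ltac zmodule :=
  apply: eq_of_diff;
  rewrite !(opprD, opprK, oppr0) -?addrA;
  repeat cancel_head.

(** * Automorphisms as pairs of inverse additive maps *)

Section Automorphisms.
Variable X : zmodType.
Implicit Types f : X -> X.

Lemma zmod_morphismP f : zmod_morphism f ->
  exists F : {additive X -> X}, f = F :> (X -> X).
Proof.
move=> fB.
pose F : {additive X -> X} := HB.pack f (GRing.isZmodMorphism.Build X X f fB).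
by exists F.
Qed.

Lemma automorphismP f : is_automorphism f ->
  exists F G : {additive X -> X},
    [/\ f = F :> (X -> X), cancel F G & cancel G F].
Proof.
move=> [/zmod_morphismP[F ->] [g FK gK]].
have [G gE] := zmod_morphismP (can2_zmod_morphism FK gK).
by exists F, G; rewrite -gE.
Qed.

Lemma additive_automorphism (F G : {additive X -> X}) :
  cancel F G -> cancel G F -> is_automorphism F.
Proof. by move=> FK GK; split; [exact: raddfB | exists G]. Qed.

End Automorphisms.

(** * The intermediate parametrization *)

(** The letters stand for b, u = 1 - a and v = 1 - d, a prime for the inverse;
   the inverses are fields so that they too are available as additive maps. *)
Record coefs (X : zmodType) := Coefs {
  cb : {additive X -> X}; cb' : {additive X -> X};
  cu : {additive X -> X}; cu' : {additive X -> X};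
  cv : {additive X -> X}; cv' : {additive X -> X};
  cbK : cancel cb cb'; cbVK : cancel cb' cb;
  cuK : cancel cu cu'; cuVK : cancel cu' cu;
  cvK : cancel cv cv'; cvVK : cancel cv' cv;
  coefs_comm : forall x, cb (cu (cv x)) = cu (cv (cb x));
  coefs_rel : forall x, cb (cv x) + cu (cb x) = cb x + cb (cu (cv x)) }.

Definition braiding (X : zmodType) (D : coefs X) (t : X * X) : X * X :=
  (t.1 - cu D t.1 + cb D t.2, cv D (cb' D (cu D t.1)) + (t.2 - cv D t.2)).

Definition triple (X : zmodType) (D : coefs X) :
    (X -> X) * (X -> X) * (X -> X) :=
  (cb D : X -> X, cb D \o cv' D \o cu' D, cb D \o cu' D).

(** * The braiding attached to (b, u, v) is a solution *)

Section Braiding.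
Variables (X : zmodType) (D : coefs X).

Local Notation b := (cb D).
Local Notation b' := (cb' D).
Local Notation u := (cu D).
Local Notation u' := (cu' D).
Local Notation v := (cv D).
Local Notation v' := (cv' D).
Local Notation S := (braiding D).

Let addE := (raddfD b, raddfN b, raddf0 b, raddfD u, raddfN u, raddf0 u,
  raddfD v, raddfN v, raddf0 v, raddfD b', raddfN b', raddf0 b',
  raddfD v', raddfN v', raddf0 v').
Local Notation tau x := (b (v' x)).
Local Notation tau' x := (v (b' x)).

Lemma coefs_relE x : u (b x) = b x + b (u (v x)) - b (v x).
Proof. by rewrite -coefs_rel addrC addKr. Qed.

(** The maps t |-> x + tau t satisfy the defining relations of the structure
   group because tau v = b and tau c = u. *)
Lemma affine_product x y t :
  x + tau (y + tau t) = (S (x, y)).1 + tau ((S (x, y)).2 + tau t).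
Proof. by rewrite /= !addE !cvK cbVK; zmodule. Qed.

Lemma braiding_zmod_morphism : zmod_morphism S.
Proof.
move=> [x1 x2] [y1 y2]; rewrite /braiding /=.
by congr pair => /=; rewrite !addE; zmodule.
Qed.

(** If S (x, y) = 0 then x = - tau y by [affine_product]; with y = v w, the
   vanishing of the first coordinate becomes b u v w = 0 by the second relation
   of (R). *)
Lemma braiding_injective : injective S.
Proof.
move=> t1 t2 eqS; apply/eqP; rewrite -subr_eq0.
have: S (t1 - t2) = 0 by rewrite braiding_zmod_morphism eqS subrr.
move: (t1 - t2) => [x y]; rewrite -[y](cvVK D); move: (v' y) => w Sxw.
have := affine_product x (v w) 0.
rewrite Sxw !(addE, addr0) cvK => /eqP; rewrite addr_eq0 => /eqP xE.
have := congr1 fst Sxw; rewrite /= xE !addE coefs_relE => fst0.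
have /eqP: b (u (v w)) = 0 by rewrite -[RHS]fst0; zmodule.
rewrite (raddf_eq0 _ (can_inj (@cbK _ D))) (raddf_eq0 _ (can_inj (@cuK _ D))).
by rewrite (raddf_eq0 _ (can_inj (@cvK _ D))) => /eqP ->; rewrite !addE oppr0.
Qed.

(** To solve S (x, y) = (s, t), put m = s + tau t, which is x + tau y by
   [affine_product], and y = v w; the first coordinate then reads
   b u v w = u m - tau t. *)
Definition braiding_inv (t : X * X) : X * X :=
  let m := t.1 + tau t.2 in
  let w := v' (u' (b' (u m - tau t.2))) in
  (m - b w, v w).

Lemma braiding_invK : cancel braiding_inv S.
Proof.
move=> [s t]; set w := v' (u' (b' (u (s + tau t) - tau t))).
have wE : b (u (v w)) = u (s + tau t) - tau t by rewrite cvVK cuVK cbVK.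
have fstE : (S (braiding_inv (s, t))).1 = s.
  by rewrite /= -/w !addE (coefs_relE w) wE !addE; zmodule.
rewrite [LHS]surjective_pairing fstE; congr pair.
have := affine_product (braiding_inv (s, t)).1 (braiding_inv (s, t)).2 0.
rewrite -surjective_pairing fstE; move: (S _).2 => r.
rewrite (raddf0 v') (raddf0 b) !addr0 /= -/w cvK subrK => /addrI.
by move=> /(congr1 b'); rewrite !cbK => /(congr1 v); rewrite !cvVK.
Qed.

Lemma braiding_bijective : bijective S.
Proof.
exists braiding_inv; last exact: braiding_invK.
exact: inj_can_sym braiding_invK braiding_injective.
Qed.

(** The maps g_x act on X: the terms in y cancel by the second relation of (R)
   at y, those in x by the same relation at r = b^-1 u x. *)
Lemma gmap_action x y w :
  gmap S x (gmap S y w) = gmap S (gmap S x y) (gmap S (fmap S y x) w).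
Proof.
rewrite /gmap /fmap /=.
have: b (b' (u x)) = u x by rewrite cbVK.
move: (b' (u x)) => r rE.
by rewrite !addE -rE !coefs_relE; zmodule.
Qed.

(** The maps f_y act on X on the right.  Since c
   factors as v b^-1 u on the left, everything reduces to the identity
   b r = u (v y + s - v s) for (s, r) = S (y, w). *)
Lemma fmap_action x y w :
  fmap S w (fmap S y x) = fmap S (fmap S w y) (fmap S (gmap S y w) x).
Proof.
pose s := gmap S y w; pose r := fmap S w y.
have rE : v r = v (b' (u (v y + s - v s))).
  congr (v _); apply: (can_inj (@cbK _ D)); rewrite cbVK /r /s /gmap /fmap /=.
  have: b (b' (u y)) = u y by rewrite cbVK.
  move: (b' (u y)) => e eE.
  by rewrite !addE -eE -!coefs_comm !coefs_relE; zmodule.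
rewrite -/s -/r {1 3}/fmap /= rE {1}/r /fmap /= !addE; zmodule.
Qed.

(** The value at 0 of the product of the three affine maps of x, y and w. *)
Definition triple_product (t : X * X * X) : X :=
  t.1.1 + tau (t.1.2 + tau t.2).

Lemma triple_product_S1 t : triple_product (S1 S t) = triple_product t.
Proof. by case: t => [[x y] w]; rewrite /triple_product -affine_product. Qed.

Lemma triple_product_S2 t : triple_product (S2 S t) = triple_product t.
Proof.
case: t => [[x y] w]; have := affine_product y w 0.
by rewrite /triple_product (raddf0 v') (raddf0 b) !addr0 /= => ->.
Qed.

Lemma braiding_yang_baxter t : S1 S (S2 S (S1 S t)) = S2 S (S1 S (S2 S t)).
Proof.
have: triple_product (S1 S (S2 S (S1 S t))) =
      triple_product (S2 S (S1 S (S2 S t))).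
  by rewrite !(triple_product_S1, triple_product_S2).
case: t => [[x y] w].
rewrite /S1 /S2 /triple_product -fmap_action (gmap_action x y w).
move=> /addrI /(congr1 b'); rewrite !cbK => /(congr1 v); rewrite !cvVK.
by move=> /addIr /= ->.
Qed.

Lemma braiding_nondegenerate : Defs.nondegenerate S.
Proof.
split=> [x|y].
  exists (fun s => b' (s - (x - u x))) => s; rewrite /gmap /=.
    by rewrite addrC addKr cbK.
  by rewrite cbVK addrC subrK.
exists (fun s => u' (b (v' (s - (y - v y))))) => s; rewrite /fmap /=.
  by rewrite addrK cvK cbVK cuK.
by rewrite cuVK cbK cvVK subrK.
Qed.

(** The affine action of the structure group, on the letters of its words; in a
   letter the boolean true marks a formal inverse. *)
Definition letter_act (l : bool * X) (t : X) : X :=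
  if l.1 then tau' (t - l.2) else l.2 + tau t.

Definition word_act (w : word X) (t : X) : X := foldr letter_act t w.

Lemma word_act_cong w1 w2 : word_cong S w1 w2 -> word_act w1 =1 word_act w2.
Proof.
elim=> {w1 w2} [w|w1 w2 _ IH|w2 w1 w3 _ IH1 _ IH2|l r w1 w2 _ IH|e x|x y] t //.
- by rewrite IH1.
- by rewrite /word_act !foldr_cat; congr foldr; apply: IH.
- rewrite /word_act /letter_act /=; case: e => /=.
    by rewrite addrC addKr cbK cvVK.
  by rewrite cvK cbVK addrC subrK.
- exact: affine_product.
Qed.

Lemma braiding_injective_braided : injective_braided S.
Proof.
move=> x y /sg_classP/word_act_cong/(_ 0).
by rewrite /word_act /letter_act /= => /addIr.
Qed.

Lemma braiding_solution : linear_solution S.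
Proof.
split.
- by split; [exact: braiding_zmod_morphism | exact: braiding_bijective].
- by split; [exact: braiding_bijective | exact: braiding_yang_baxter].
- exact: braiding_nondegenerate.
- exact: braiding_injective_braided.
Qed.

Lemma attached_braiding t : attached S t <-> t = triple D.
Proof.
have aE x : x - coef_a S x = u x.
  by rewrite /coef_a /= (raddf0 b) addr0; zmodule.
have dE x : x - coef_d S x = v x.
  by rewrite /coef_d /= !addE add0r; zmodule.
have bE x : coef_b S x = b x.
  by rewrite /coef_b /= !addE subr0 add0r.
case: t => [[p q] z] /=; split=> [[pE zE qE]|[-> -> ->]].
  congr (_, _, _); apply: funext => x /=; rewrite -bE ?pE //.
    by rewrite -qE dE aE cvVK cuVK.
  by rewrite -zE aE cuVK.
by split=> x; rewrite ?bE ?dE ?aE //= !cuK ?cvK.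
Qed.

Lemma triple_auto : auto_triple (triple D).
Proof.
split=> [||| x | x] /=.
- exact: additive_automorphism (@cbK _ D) (@cbVK _ D).
- apply: (@additive_automorphism _ (b \o v' \o u') (u \o v \o b')) => x /=.
    by rewrite cbK cvVK cuVK.
  by rewrite cuK cvK cbVK.
- apply: (@additive_automorphism _ (b \o u') (u \o b')) => x /=.
    by rewrite cbK cuVK.
  by rewrite cuK cbVK.
- rewrite -[x](cuVK D) -[u' x](cvVK D); move: (v' (u' x)) => w.
  by rewrite cuK cvK coefs_comm cuK cvK.
rewrite -[x](cuVK D) -[u' x](cvVK D); move: (v' (u' x)) => w.
rewrite !cuK cvK [_ + b w]addrC -coefs_rel (raddfD u') cuK (raddfD b).
by zmodule.
Qed.

End Braiding.

(** * Parameters (b, u, v) and triples (p, q, z) *)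

Section Classification.
Variable X : zmodType.

Lemma triple_inj (D E : coefs X) :
  triple D = triple E -> braiding D = braiding E.
Proof.
move=> [bE qE zE].
have {}bE x : cb D x = cb E x by rewrite bE.
have b'E x : cb' D x = cb' E x.
  by apply: (can_inj (@cbK _ D)); rewrite cbVK bE cbVK.
have u'E x : cu' D x = cu' E x.
  by apply: (can_inj (@cbK _ D)); rewrite [RHS]bE; have /= := congr1 (@^~ x) zE.
have uE x : cu D x = cu E x.
  by apply: (can_inj (@cuVK _ D)); rewrite cuK u'E cuK.
have v'E x : cv' D x = cv' E x.
  apply: (can_inj (@cbK _ D)); rewrite [RHS]bE.
  by have /= := congr1 (@^~ (cu D x)) qE; rewrite cuK uE cuK.
have vE x : cv D x = cv E x.
  by apply: (can_inj (@cvVK _ D)); rewrite cvK v'E cvK.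
by apply: funext => -[x y]; rewrite /braiding /= !bE !uE b'E !vE.
Qed.

(** u = z^-1 p and v = p^-1 z q^-1 p; substituting x = p^-1 q y in the second
   relation of (R) and applying z yields the quadratic relation at y. *)
Lemma triple_surj (t : (X -> X) * (X -> X) * (X -> X)) :
  auto_triple t -> exists D : coefs X, t = triple D.
Proof.
case: t => [[p q] z] [].
move=> /automorphismP[P [P' [-> PK PVK]]] /automorphismP[Q [Q' [-> QK QVK]]].
move=> /automorphismP[Z [Z' [-> ZK ZVK]]] pq zz.
unshelve eexists (@Coefs X P P' (Z' \o P) (P' \o Z) (P' \o Z \o Q' \o P)
   (P' \o Q \o Z' \o P) _ _ _ _ _ _ _ _) => //= [x|x|x|x|x|x|] /=.
- by rewrite ZVK PK.
- by rewrite PVK ZK.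
- by rewrite PVK ZK QVK PK.
- by rewrite PVK QK ZVK PK.
- rewrite !(PVK, ZK); apply: (can_inj QK).
  by rewrite QVK -pq QVK.
- rewrite !(PVK, ZK); apply: (can_inj ZK); rewrite raddfD ZVK.
  rewrite -[in P (P x)](QVK (P x)) -[X in _ = Z (X + _)](QVK (P x)).
  move: (Q' (P x)) => y; apply/eqP; rewrite -subr_eq0 -(zz y).
  by rewrite [P y + _]addrC addrAC.
by congr (_, _, _); apply: funext => x /=; rewrite !(PVK, ZVK, PK, ZK).
Qed.

End Classification.

(** * Every solution comes from a triple (b, u, v) *)

Section Solution.
Variables (X : zmodType) (S : X * X -> X * X).

Lemma linear_set_additive : linear_set S ->
  exists a b c d : {additive X -> X},
    forall x y, S (x, y) = (a x + b y, c x + d y).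
Proof.
move=> linS; have SB := linS.1.
have pairB (x1 x2 y1 y2 : X) : (x1 - y1, x2 - y2) = (x1, x2) - (y1, y2) by [].
have aB : zmod_morphism (coef_a S).
  by move=> x y; rewrite /coef_a -[X in (_, X)]subr0 pairB SB.
have bB : zmod_morphism (coef_b S).
  by move=> x y; rewrite /coef_b -[X in (X, _ - _)]subr0 pairB SB.
have cB : zmod_morphism (coef_c S).
  by move=> x y; rewrite /coef_c -[X in (_, X)]subr0 pairB SB.
have dB : zmod_morphism (coef_d S).
  by move=> x y; rewrite /coef_d -[X in (X, _ - _)]subr0 pairB SB.
have [a aE] := zmod_morphismP aB; have [b bE] := zmod_morphismP bB.
have [c cE] := zmod_morphismP cB; have [d dE] := zmod_morphismP dB.
by exists a, b, c, d => x y; rewrite (linear_setE linS) aE bE cE dE.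
Qed.

(** By cancellation in the relation x y = g_x(y) f_y(x) of the structure
   group. *)
Lemma injective_fixed x y :
  injective_braided S -> (gmap S x y = x <-> fmap S y x = y).
Proof.
move=> injS; split=> fix_xy; have := structure_map_rel S x y; rewrite fix_xy.
  by move=> /mulgI /injS.
by move=> /mulIg /injS.
Qed.

(** The equivalence b y = u x <-> c x = v y yields the right inverses
   c^-1 v b^-1 of u and b^-1 u c^-1 of v, and also the injectivity of u and v. *)
Lemma solution_braiding :
  linear_solution S -> exists D : coefs X, S = braiding D.
Proof.
case=> linS [_ YB] [g_bij f_bij] injS.
have [a [b [c [d SE]]]] := linear_set_additive linS.
have gE x y : gmap S x y = a x + b y by rewrite /gmap SE.
have fE x y : fmap S y x = c x + d y by rewrite /fmap SE.
have [b' bK bVK] : bijective b.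
  by apply: eq_bij (g_bij 0) _ _ => y; rewrite gE raddf0 add0r.
have [c' cK cVK] : bijective c.
  by apply: eq_bij (f_bij 0) _ _ => x; rewrite fE raddf0 addr0.
have [u uE] : exists u : {additive X -> X}, forall x, u x = x - a x.
  have /zmod_morphismP[u uE] : zmod_morphism (fun x => x - a x).
    by move=> x y; rewrite raddfB; zmodule.
  by exists u => x; rewrite -uE.
have [v vE] : exists v : {additive X -> X}, forall x, v x = x - d x.
  have /zmod_morphismP[v vE] : zmod_morphism (fun x => x - d x).
    by move=> x y; rewrite raddfB; zmodule.
  by exists v => x; rewrite -vE.
have aE x : a x = x - u x by rewrite uE; zmodule.
have dE x : d x = x - v x by rewrite vE; zmodule.
have fixE x y : b y = u x <-> c x = v y.
  have := injective_fixed x y injS; rewrite gE fE uE vE => gf.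
  split=> E.
    by apply: (canRL (addrK _)); apply/gf; rewrite E addrC subrK.
  by apply: (canRL (addrK _)); rewrite addrC; apply/gf; rewrite E subrK.
have uVK : cancel (fun s => c' (v (b' s))) u.
  by move=> s; rewrite -[RHS]bVK; symmetry; apply/fixE; rewrite cVK.
have vVK : cancel (fun s => b' (u (c' s))) v.
  by move=> s; rewrite -[RHS]cVK; symmetry; apply/fixE; rewrite bVK.
have u_inj : injective u.
  apply: raddf_inj => x ux0; apply: (can_inj cK); rewrite raddf0 -(raddf0 v).
  by apply/fixE; rewrite ux0 raddf0.
have v_inj : injective v.
  apply: raddf_inj => x vx0; apply: (can_inj bK); rewrite raddf0 -(raddf0 u).
  by apply/fixE; rewrite vx0 raddf0.
have uK := inj_can_sym uVK u_inj; have vK := inj_can_sym vVK v_inj.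
have [B' B'E] := zmod_morphismP (can2_zmod_morphism bK bVK).
have [U' U'E] := zmod_morphismP (can2_zmod_morphism uK uVK).
have [V' V'E] := zmod_morphismP (can2_zmod_morphism vK vVK).
rewrite {}B'E in bK bVK; rewrite {}U'E in uK uVK; rewrite {}V'E in vK vVK.
have addE := (raddfD b, raddfN b, raddf0 b, raddfD u, raddfN u, raddf0 u,
  raddfD v, raddfN v, raddf0 v).
(* first coordinate of the braid equation on (0, x, 0) *)
have rel x : b (v x) + u (b x) = b x + b (u (v x)).
  have := congr1 (fun t => t.1.1) (YB (0, x, 0)).
  rewrite /S1 /S2 /= !gE !fE !(raddf0, addr0, add0r) !(aE, dE) => /esym.
  by apply: eq_by_diff; rewrite !addE; zmodule.
(* second coordinate on (0, 0, x), compared with the previous relation *)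
have comm x : b (u (v x)) = u (v (b x)).
  have := congr1 (fun t => t.1.2) (YB (0, 0, x)).
  rewrite /S1 /S2 /= !gE !fE !(raddf0, addr0, add0r) !(aE, dE).
  move=> YBx; apply: (addrI (b x)); rewrite -rel.
  by apply: eq_by_diff YBx; rewrite !addE; zmodule.
exists (Coefs bK bVK uK uVK vK vVK comm rel).
apply: funext => -[x y]; rewrite SE /braiding /= aE dE.
by congr (_, _ + _); apply/fixE; rewrite bVK.
Qed.

End Solution.

Theorem corollary1 (X : zmodType) :
  exists Phi : (X * X -> X * X) -> (X -> X) * (X -> X) * (X -> X),
    set_bij [set S | @linear_solution X S] [set t | @auto_triple X t] Phi /\
    (forall S : X * X -> X * X, linear_solution S -> attached S (Phi S)).
Proof.
have [S|Phi PhiE] := @choice _ _ (fun S t => linear_solution S ->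
    exists2 D : coefs X, S = braiding D & t = triple D).
  have [/solution_braiding[D ->]|nsol] := pselect (linear_solution S).
    by exists (triple D) => _; exists D.
  by exists (idfun, idfun, idfun) => /nsol.
exists Phi; split; last first.
  by move=> S /PhiE[D -> ->]; apply/attached_braiding.
split=> [S /= /PhiE[D _ ->]|S T|t /= /triple_surj[D ->]].
- exact: triple_auto.
- rewrite !inE /= => /PhiE[D -> ->] /PhiE[E -> ->]; exact: triple_inj.
- have sol := braiding_solution D; exists (braiding D) => //.
  have [E DE ->] := PhiE _ sol.
  by apply/attached_braiding; rewrite DE; apply/attached_braiding.
Qed.
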